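(* Let $T$ be a tree with a proper 2-coloring $\chi:V(T)\to\{\mathcal{R},\mathcal{B}\}$. Then $T$ is unmixed if and only if every connected component $T'$ of $T_\mathcal{B}$ and of $T_\mathcal{R}$ satisfies: (1) $\mathrm{height}(T')\le 3$; (2) for all $v\in V_2(T')$, $|N_{T'}(v)\cap V_1(T')|=1$; and (3) for all $v\in V_1(T')$, $|N_{T'}(v)\cap V_2(T')|\le 1$.
   Context: $N_G(v)=\{u: uv\in E(G)\}$, $N(D)=\bigcup_{v\in D}N(v)$, $N[U]=N(U)\cup U$. A TD-set of $G$ is $D\subseteq V(G)$ with $N(D)=V(G)$; minimal if no proper subset is a TD-set; $G$ is unmixed if all its minimal TD-sets have the same size. A leaf is a vertex of degree 1, a support vertex is one adjacent to a leaf. The height of a vertex of a graph is its minimum distance to a leaf of that graph (isolated vertices have height 0); $V_k(G)$ is the set of vertices of height $k$, and $\mathrm{height}(G)=\max\{k: V_k(G)\ne\emptyset\}$. The blue interior graph $T_\mathcal{B}$ is the subgraph of $T$ induced on $V(T)\setminus N[V_1(T)\cap\chi^{-1}(\mathcal{B})]$; the red interior graph $T_\mathcal{R}$ is the subgraph induced on $V(T)\setminus N[V_1(T)\cap\chi^{-1}(\mathcal{R})]$. *)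

(* Defs.v *)
(* A simple graph is a symmetric irreflexive relation e on a finType V. *)
From mathcomp Require Import all_boot all_order.
Set Implicit Arguments. Unset Strict Implicit. Unset Printing Implicit Defensive.

Section Graphs.
Variables (V : finType) (e : rel V).

Definition connected_graph : Prop := forall x y : V, connect e x y.
Definition acyclic_graph : Prop :=
  ~ exists c : seq V, [&& uniq c, 2 < size c & cycle e c].
Definition is_tree : Prop := [/\ 0 < #|V|, connected_graph & acyclic_graph].

(* chi : V -> bool, colour true / false play the roles of R / B *)
Definition proper_2coloring (chi : V -> bool) : Prop :=
  forall x y, e x y -> chi x != chi y.

Definition N (v : V) : {set V} := [set u | e u v].
Definition NS (D : {set V}) : {set V} := \bigcup_(v in D) N v.
Definition Ncl (U : {set V}) : {set V} := NS U :|: U.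

Definition TDset (D : {set V}) : bool := NS D == [set: V].
Definition minimal_TDset (D : {set V}) : Prop :=
  TDset D /\ forall D' : {set V}, D' \proper D -> ~~ TDset D'.
Definition unmixed : Prop :=
  forall D1 D2, minimal_TDset D1 -> minimal_TDset D2 -> #|D1| = #|D2|.

Section Induced.
Variable S : {set V}.
Definition eS : rel V := [rel x y | [&& x \in S, y \in S & e x y]].
Definition NSub (v : V) : {set V} := [set u in S | e v u].
Definition leafS (v : V) : bool := (v \in S) && (#|NSub v| == 1).
Definition isolatedS (v : V) : bool := (v \in S) && (NSub v == set0).
Fixpoint walk_reach (d : nat) (v : V) : {set V} :=
  match d with
  | 0 => [set x in S | x == v]
  | d'.+1 => [set u in S | [exists w in walk_reach d' v, e w u]]
  end.
Definition leaf_at (d : nat) (v : V) : bool :=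
  [exists u in walk_reach d v, leafS u].
(* V_k(G[S]) : vertices of height k (min. distance to a leaf; isolated => 0) *)
Definition Vk (k : nat) : {set V} :=
  [set v in S | if isolatedS v then k == 0
                else leaf_at k v && [forall j : 'I_k, ~~ leaf_at j v]].
Definition height_le (m : nat) : Prop := forall k, Vk k != set0 -> k <= m.
End Induced.

Definition is_component (S C : {set V}) : Prop :=
  exists2 v, v \in S & C = [set u in S | connect (eS S) v u].

Definition interior (chi : V -> bool) (c : bool) : {set V} :=
  ~: Ncl (Vk [set: V] 1 :&: [set v | chi v == c]).

Definition good_component (C : {set V}) : Prop :=
  [/\ height_le C 3,
      forall v, v \in Vk C 2 -> #|NSub C v :&: Vk C 1| = 1
    & forall v, v \in Vk C 1 -> #|NSub C v :&: Vk C 2| <= 1].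

End Graphs.

(* Main.v *)
(* Total domination splits over the colour classes: the vertices of colour c in a
   minimal TD-set form a minimal set dominating the vertices of the other colour.
   Such a set contains every support vertex of colour c, and the rest of it is a
   minimal set dominating the other-coloured vertices of the interior graph, each
   of which has degree at least 2 there.  So T is unmixed iff, for both colours,
   the hypergraph A of neighbourhoods of these vertices has minimal transversals
   of a single size.

   This hypergraph satisfies Konig's property, since T is a tree: some transversal
   D and some matching M in A have the same size.  If all minimal transversals
   have size #|M|, each of them picks one vertex from each member of M and no
   other vertex.  Choosing minimal transversals through one or two prescribed
   vertices then shows that M partitions the vertices covered by A, and that each
   member of M has at most one vertex lying in another member of A.  Hence M is
   the set of height-1 vertices of the interior graph, and conditions (1)-(3)
   express exactly this.  Conversely, under these conditions every minimal
   transversal meets each height-1 neighbourhood exactly once, hence has as many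
   elements as there are height-1 vertices.  Trees with at most two vertices are
   treated apart, as their support vertices are leaves. *)
Require Import Defs.
From mathcomp Require Import all_boot all_order.
Set Implicit Arguments. Unset Strict Implicit. Unset Printing Implicit Defensive.

(** * Minimal dominating sets *)

Section Domination.
Variables (V : finType) (e : rel V).

Definition dom (A D : {set V}) : bool :=
  [forall a in A, [exists x in D, e x a]].

(** Minimality is encoded by private neighbours, which are easy to carry from one colour class to
    the whole tree and back. *)
Definition mindom (A D : {set V}) : Prop :=
  dom A D /\
  forall x, x \in D ->
    exists a, [/\ a \in A, e x a & forall y, y \in D -> e y a -> y = x].

Lemma domP (A D : {set V}) :
  reflect (forall a, a \in A -> exists2 x, x \in D & e x a) (dom A D).
Proof.
apply: (iffP forall_inP) => H a /H; first by case/exists_inP=> x; exists x.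
by case=> x xD exa; apply/exists_inP; exists x.
Qed.

(** In an inclusion-minimal dominating subset, removing [x] leaves some [a] undominated, and this
    [a] is private to [x]. *)
Lemma mindom_exists A D : dom A D -> exists2 D' : {set V}, D' \subset D & mindom A D'.
Proof.
move=> domD; have [D' /minsetP[domD' minD'] sD'D] := minset_exists domD.
exists D' => //; split=> // x xD'.
have: ~~ dom A (D' :\ x).
  by apply/negP=> /minD' /(_ (subsetDl _ _)) eqD; rewrite -eqD !inE eqxx in xD'.
case/forall_inPn=> a aA /exists_inPn Ha; exists a.
have only y : y \in D' -> e y a -> y = x.
  by move=> yD eya; apply: contraTeq eya => nyx; apply: Ha; rewrite !inE nyx.
split=> //; have [y yD' eya] := domP _ _ domD' a aA.
by rewrite -(only y yD' eya).
Qed.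

Lemma TDset_dom D : symmetric e -> TDset e D = dom setT D.
Proof.
move=> es; apply/eqP/domP => [H a _ | H].
  have: a \in NS e D by rewrite H inE.
  by case/bigcupP=> x xD; rewrite inE es => exa; exists x.
apply/setP=> a; rewrite inE; have [x xD exa] := H a (in_setT a).
by apply/bigcupP; exists x; rewrite // inE es.
Qed.

Lemma minimal_TDset_mindom D :
  symmetric e -> minimal_TDset e D <-> mindom setT D.
Proof.
move=> es; split=> [[TD minD] | [domD priv]].
  rewrite TDset_dom // in TD; have [D' sD'D mD'] := mindom_exists TD.
  have [<- // | nD] := eqVneq D' D.
  have /minD : D' \proper D by rewrite properEneq nD.
  by rewrite TDset_dom // mD'.1.
split=> [|D' /properP[sD' [x xD xD']]]; first by rewrite TDset_dom.
rewrite TDset_dom //; apply/negP=> /domP domD'.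
have [a [_ _ only]] := priv x xD.
have [y yD' eya] := domD' a (in_setT a).
by rewrite -(only y (subsetP sD' y yD') eya) yD' in xD'.
Qed.

(** Without edges from either set to the targets of the other, private neighbours stay private; this
    glues the two colour classes. *)
Lemma mindomU (A1 A2 D1 D2 : {set V}) :
    (forall x a, x \in D1 -> a \in A2 -> ~~ e x a) ->
    (forall x a, x \in D2 -> a \in A1 -> ~~ e x a) ->
  mindom A1 D1 -> mindom A2 D2 -> mindom (A1 :|: A2) (D1 :|: D2).
Proof.
move=> no12 no21 [/domP dom1 priv1] [/domP dom2 priv2]; split.
  apply/domP=> a /setUP[/dom1 | /dom2] [x xD exa]; exists x => //.
    by rewrite inE xD.
  by rewrite inE xD orbT.
move=> x /setUP[/priv1 | /priv2] [a [aA exa only]]; exists a; split=> //.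
- by rewrite inE aA.
- by move=> y /setUP[/only //| yD2] eya; have := no21 y a yD2 aA; rewrite eya.
- by rewrite inE aA orbT.
- by move=> y /setUP[yD1|/only //] eya; have := no12 y a yD1 aA; rewrite eya.
Qed.

(* Choosing in D a neighbour of each m \in M is injective on M, hence onto D. *)
Lemma leq_card_select (M D : {set V}) :
    (forall m m' x, m \in M -> m' \in M -> e x m -> e x m' -> m = m') ->
    dom M D -> #|D| <= #|M| ->
  (forall x, x \in D -> exists2 m, m \in M & e x m) /\
  (forall x y m, x \in D -> y \in D -> m \in M -> e x m -> e y m -> x = y).
Proof.
move=> disj /domP domM leDM.
pose g m := odflt m [pick x in D | e x m].
have gP m : m \in M -> (g m \in D) && e (g m) m.
  move=> mM; rewrite /g; case: pickP => //= none.
  by have [x xD exm] := domM m mM; have := none x; rewrite xD exm.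
have inj_g : {in M &, injective g}.
  move=> m m' mM m'M eqg; case/andP: (gP m mM) => _ egm.
  by case/andP: (gP m' m'M) => _; rewrite -eqg => egm'; apply: disj egm egm'.
have gM : g @: M = D.
  apply/eqP; rewrite eqEcard card_in_imset // leDM andbT.
  by apply/subsetP=> _ /imsetP[m /gP/andP[gD _] ->].
have cover x : x \in D -> exists2 m, m \in M & x = g m.
  by rewrite -gM => /imsetP.
split=> [x /cover[m mM ->] | x y m /cover[m1 mM1 ->] /cover[m2 mM2 ->] mM e1 e2].
  by exists m => //; case/andP: (gP m mM).
have /andP[_ em1] := gP _ mM1; have /andP[_ em2] := gP _ mM2.
by rewrite -(disj _ _ _ mM mM1 e1 em1) -(disj _ _ _ mM mM2 e2 em2).
Qed.

End Domination.

(** * Walks in induced subgraphs *)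

Section Walks.
Variables (V : finType) (e : rel V) (S : {set V}).
Hypothesis es : symmetric e.

Lemma walk_reachSP d v u :
  reflect (u \in S /\ exists2 w, w \in walk_reach e S d v & e w u)
          (u \in walk_reach e S d.+1 v).
Proof.
rewrite inE; apply: (iffP andP) => [[uS /exists_inP] | [uS H]]; split=> //.
exact/exists_inP.
Qed.

Lemma walk_reach0 v u : (u \in walk_reach e S 0 v) = (u \in S) && (u == v).
Proof. by rewrite inE. Qed.

Lemma walk_reach_sub d v u : u \in walk_reach e S d v -> u \in S.
Proof. by case: d => [|d]; rewrite inE => /andP[]. Qed.

Lemma connect_walk_reach v u :
  v \in S -> connect (eS e S) v u -> exists d, u \in walk_reach e S d v.
Proof.
move=> vS /connectP[p]; elim/last_ind: p u => [|p w IH] u /=.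
  by move=> _ ->; exists 0; rewrite walk_reach0 vS eqxx.
rewrite rcons_path last_rcons => /andP[pp lw] ->.
have [d Hd] := IH _ pp erefl; exists d.+1.
case/and3P: lw => _ wS ew.
by apply/walk_reachSP; split=> //; exists (last v p).
Qed.

Lemma walk_reach_colour (chi : V -> bool) d v u :
    proper_2coloring e chi ->
  u \in walk_reach e S d v -> chi u = chi v (+) odd d.
Proof.
move=> hchi; elim: d u => [|d IH] u.
  by rewrite walk_reach0 => /andP[_ /eqP->]; rewrite addbF.
case/walk_reachSP=> _ [w /IH Hw /hchi]; rewrite /= Hw.
by case: (chi u) (chi v) (odd d) => [] [] [].
Qed.

End Walks.

(** * Acyclicity *)

Section Trees.
Variables (V : finType) (e : rel V) (chi : V -> bool).
Hypotheses (es : symmetric e) (ei : irreflexive e).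
Hypotheses (ac : acyclic_graph e) (hchi : proper_2coloring e chi).

(** A path from [u] to [w] avoiding [v] would close up to a cycle through [v]. *)
Lemma acyclic_detour v u w :
    e u v -> e w v -> u != w ->
  ~~ connect [rel x y | [&& e x y, x != v & y != v]] u w.
Proof.
move=> euv ewv nuw; apply/negP=> /connectP[p0 pp0 lw].
move: nuw; rewrite lw => nuw; rewrite {}lw in ewv.
case/shortenP: pp0 ewv nuw => p pp up _ ewv nuw.
have allv x q : path [rel x y | [&& e x y, x != v & y != v]] x q ->
    (v \notin q) && path e x q.
  elim: q x => //= y q IH x /andP[/and3P[exy _ nyv] /IH/andP[nvq ->]].
  by rewrite inE negb_or eq_sym nyv nvq exy.
have /andP[nvp ep] := allv _ _ pp; apply: ac; exists (v :: u :: p).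
(* An empty path would force [u = w], so the cycle has at least three vertices. *)
case: p pp up ewv nuw nvp ep {allv} => [|x p]; first by rewrite /= eqxx.
move=> _ up ewv _ nvp ep; apply/and3P; split=> //.
  rewrite cons_uniq up andbT inE negb_or nvp andbT.
  by apply/eqP=> vu; rewrite vu ei in euv.
by rewrite (cycle_path v) /= -/(last x p) ewv es euv; exact: ep.
Qed.

Lemma acyclic_C4 a b x y :
  e x a -> e x b -> e y a -> e y b -> a != b -> x = y.
Proof.
move=> xa xb ya yb nab; case: (eqVneq x y) => // nxy; case: ac.
exists [:: a; x; b; y]; rewrite /= !inE !negb_or nab nxy /=.
have neq u v : e u v -> (u == v) = false.
  by move=> uv; apply/eqP=> uv'; rewrite uv' ei in uv.
rewrite (es a x) (es b y) xa xb ya yb.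
by rewrite (eq_sym a) (eq_sym a) (eq_sym b) !neq.
Qed.

(** Otherwise [r a1 s1 x t y s2 a2] is an 8-cycle. Its colours alternate, so only vertices of equal
    colour need to be told apart; [acyclic_C4] settles the three pairs that the hypotheses leave
    open. *)
Lemma acyclic_C8 r s1 s2 t a1 a2 x y :
    e a1 r -> e a2 r -> a1 != a2 -> e a1 s1 -> e a2 s2 ->
    s1 != r -> s2 != r -> t != r -> t != s1 -> t != s2 ->
    e x s1 -> e x t -> e y s2 -> e y t -> x != y -> x != a1 -> y != a2 ->
  False.
Proof.
move=> a1r a2r na a1s1 a2s2 ns1r ns2r ntr nts1 nts2 xs1 xt ys2 yt nxy nxa1 nya2.
have ns12 : s1 != s2.
  apply: contra_neq na => eqs; rewrite -eqs in a2s2.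
  by apply: acyclic_C4 a1r a1s1 a2r a2s2 _; rewrite eq_sym.
have nxa2 : x != a2.
  apply: contra_neq na => eqs; rewrite eqs in xs1.
  by apply: acyclic_C4 a1r a1s1 a2r xs1 _; rewrite eq_sym.
have nya1 : y != a1.
  apply: contra_neq na => eqs; rewrite eqs in ys2.
  by apply: acyclic_C4 a1r ys2 a2r a2s2 _; rewrite eq_sym.
have col u v : e u v -> chi u = ~~ chi v.
  by move/hchi; case: (chi u) (chi v) => [] [].
apply: ac; exists [:: r; a1; s1; x; t; y; s2; a2].
have ca1 := col _ _ a1r; have ca2 := col _ _ a2r.
have cs1 := col _ _ a1s1; have cs2 := col _ _ a2s2.
have cx := col _ _ xs1; have cy := col _ _ ys2; have ct := col _ _ xt.
have ncc u v : chi u = chi r -> chi v = ~~ chi r ->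
    ((u == v) = false) * ((v == u) = false).
  move=> cu cv; rewrite [v == u]eq_sym; have -> // : (u == v) = false.
  by apply/eqP=> uv; rewrite uv cv in cu; case: (chi r) cu.
have es1 : chi s1 = chi r by rewrite -[chi s1]negbK -cs1 ca1 negbK.
have es2 : chi s2 = chi r by rewrite -[chi s2]negbK -cs2 ca2 negbK.
have et : chi t = chi r by rewrite -[chi t]negbK -ct cx es1 negbK.
have ex : chi x = ~~ chi r by rewrite cx es1.
have ey : chi y = ~~ chi r by rewrite cy es2.
have cr : chi r = chi r by [].
rewrite /= !inE !negb_or (es r) (es s1) (es t) (es s2).
rewrite a1r a1s1 xs1 xt yt ys2 a2s2 a2r.
rewrite !(ncc _ _ cr ca1, ncc _ _ cr ca2, ncc _ _ cr ex, ncc _ _ cr ey,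
  ncc _ _ es1 ca1, ncc _ _ es1 ca2, ncc _ _ es1 ex, ncc _ _ es1 ey,
  ncc _ _ es2 ca1, ncc _ _ es2 ca2, ncc _ _ es2 ex, ncc _ _ es2 ey,
  ncc _ _ et ca1, ncc _ _ et ca2, ncc _ _ et ex, ncc _ _ et ey).
rewrite (eq_sym r s1) (eq_sym r t) (eq_sym r s2) (eq_sym a1 x) (eq_sym a1 y).
by rewrite (eq_sym s1 t) ns1r ntr ns2r nxa1 nya1 na nts1 ns12 nxy nxa2 nts2 nya2.
Qed.

End Trees.

(** * Depth, and the hypergraph of neighbourhoods *)

Section Hyper.
Variables (V : finType) (e : rel V) (chi : V -> bool).
Hypotheses (es : symmetric e) (ei : irreflexive e).
Hypotheses (cn : connected_graph e) (ac : acyclic_graph e).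
Hypothesis hchi : proper_2coloring e chi.

(** [d] is the distance to [r]. The colouring excludes edges within a level, and two distinct
    neighbours of [x] nearer to [r] would be connected outside [x], against [acyclic_detour]. *)
Lemma tree_depth (r : V) : exists d : V -> nat, [/\
  d r = 0,
  forall x y, e x y -> d x = (d y).+1 \/ d y = (d x).+1,
  forall x, x != r -> exists2 y, e y x & d x = (d y).+1
  & forall x y z, e y x -> e z x -> d y < d x -> d z < d x -> y = z].
Proof.
have H u : exists n, u \in walk_reach e setT n r.
  apply: connect_walk_reach; rewrite ?inE //.
  by rewrite (eq_connect (e' := e)) => // x y; rewrite /eS /= !inE.
pose d u := ex_minn (H u); exists d.
have dP u : u \in walk_reach e setT (d u) r by rewrite /d; case: ex_minnP.
have d_min u n : u \in walk_reach e setT n r -> d u <= n.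
  by rewrite /d; case: ex_minnP => m _ Hm /Hm.
have dr : d r = 0.
  by apply/eqP; rewrite -leqn0 d_min // walk_reach0 inE eqxx.
have d_edge x y : e x y -> d y <= (d x).+1.
  by move=> exy; apply/d_min/walk_reachSP; split; rewrite ?inE //; exists x.
have parent x : x != r -> exists2 y, e y x & d x = (d y).+1.
  move=> nxr; have := dP x; case dx: (d x) => [|n].
    by rewrite walk_reach0 (negPf nxr) andbF.
  case/walk_reachSP=> _ [w /d_min dw ewx]; exists w => //.
  by apply/eqP; rewrite eqSS eqn_leq dw -ltnS -dx d_edge.
split=> // [x y exy | x y z eyx ezx dy dz].
  have := hchi exy; have := d_edge _ _ exy; rewrite es in exy.
  have := d_edge _ _ exy; rewrite leq_eqVlt => /predU1P[-> | ]; first by left.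
  move=> dxy; rewrite leq_eqVlt => /predU1P[-> | ]; first by right.
  move=> dyx; have eqd : d x = d y.
    by apply/anti_leq; rewrite !ltnS in dxy dyx; rewrite dxy.
  rewrite (walk_reach_colour hchi (dP x)) (walk_reach_colour hchi (dP y)).
  by rewrite eqd eqxx.
apply: contraTeq isT => nyz; have := acyclic_detour es ei ac eyx ezx nyz.
set R := (X in connect X); have Rs : connect_sym R.
  by apply: sym_connect_sym => u v; rewrite /R /= es; congr (_ && _); apply: andbC.
(* Passing from parent to parent keeps the depth below that of [x], hence avoids [x]. *)
suff conn n u : d u <= n -> n < d x -> connect R u r.
  move/negP=> []; apply: connect_trans (conn _ y (leqnn _) dy) _.
  by rewrite Rs; apply: conn (leqnn _) dz.
elim: n u => [|n IH] u du ltn.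
  have [-> | /parent[w _ dw]] := eqVneq u r; first exact: connect0.
  by rewrite dw in du.
have [-> | /parent[w ew dw]] := eqVneq u r; first exact: connect0.
rewrite dw ltnS in du; apply: connect_trans (IH w du (ltnW ltn)).
apply: connect1; rewrite /R /= es ew /=.
apply/andP; split; apply: contraTneq ltn => eqx; rewrite -leqNgt -eqx.
  by rewrite dw ltnS.
exact: leqW.
Qed.

(* A vertex r of A of maximal depth shares only its parent b with the rest of A,
   so {r} extends the matching, and b the dominating set, found after deleting the
   neighbours of b. *)
Lemma konig (c : bool) (A : {set V}) :
    (forall a, a \in A -> chi a != c) -> (forall a, a \in A -> N e a != set0) ->
  exists M D : {set V}, [/\ M \subset A, dom e A D, #|D| <= #|M|
    & forall m m' x, m \in M -> m' \in M -> e x m -> e x m' -> m = m'].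
Proof.
move=> Acol Anbr; have [A0 | [a0 a0A]] := set_0Vmem A.
  exists set0, set0; split; rewrite ?sub0set ?cards0 //.
    by apply/domP=> a; rewrite A0 inE.
  by move=> m m' x; rewrite inE.
(* A neighbour of a member of [A] has colour [c]; rooting the tree there gives every member of [A] a
   parent. *)
have /set0Pn[rt] := Anbr _ a0A; rewrite inE => ert.
have crt : chi rt = c.
  by have := Acol _ a0A; have := hchi ert; case: (chi rt) (chi a0) (c) => [] [] [].
have {a0 a0A ert Anbr} nrt a : a \in A -> a != rt.
  by move/Acol; apply: contraNneq => ->; rewrite crt.
have [d [d0 d_edge parent uniq_parent]] := tree_depth rt.
move: {2}#|A| (leqnn #|A|) => n.
elim: n A Acol nrt => [|n IH] A Acol nrt leA.
  have A0 : A = set0 by apply/eqP; rewrite -cards_eq0 -leqn0.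
  exists set0, set0; split; rewrite ?sub0set ?cards0 //.
    by apply/domP=> a; rewrite A0 inE.
  by move=> m m' x; rewrite inE.
have [A0 | [r0 r0A]] := set_0Vmem A.
  by apply: IH => //; rewrite A0 cards0.
case: (arg_maxnP d r0A) => r; rewrite -/(r \in A) => rA rmax.
have [b ebr drb] := parent r (nrt r rA).
pose A' := A :\: N e b.
have sA'A : A' \subset A by apply: subsetDl.
have rA' : r \notin A' by rewrite !inE es ebr.
have [||| M [D [sMA' domD leDM disj]]] := IH A'.
- by move=> a /(subsetP sA'A)/Acol.
- by move=> a /(subsetP sA'A)/nrt.
- rewrite -ltnS; apply: leq_trans leA; apply: proper_card.
  by apply/properP; split=> //; exists r.
have nrM : r \notin M by apply: contra rA'; apply: (subsetP sMA').
(* A neighbour [x] of [r] other than [b] is a child of [r]; as [m] is no deeper than [r], both equal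
   the unique parent of [x]. *)
have rdisj m x : m \in M -> e x r -> e x m -> r = m.
  move=> /(subsetP sMA'); rewrite !inE => /andP[nbm mA] exr exm.
  have nxb : x != b by apply: contraNneq nbm => <-; rewrite es.
  have dxr : d x = (d r).+1.
    case: (d_edge _ _ exr) => // drx; case/eqP: nxb.
    by apply: uniq_parent exr ebr _ _; [rewrite drx | rewrite drb].
  apply: (uniq_parent x); rewrite 1?es ?dxr //.
  by rewrite ltnS; apply: rmax.
exists (r |: M), (b |: D); split.
- by rewrite subUset sub1set rA (subset_trans sMA').
- apply/domP=> a aA; have [eab | nab] := boolP (e a b).
    by exists b; rewrite 1?es // !inE eqxx.
  have [|x xD exa] := domP _ _ _ domD a; first by rewrite !inE nab.
  by exists x; rewrite // inE xD orbT.
- rewrite !cardsU1 nrM leq_add //; exact: leq_b1.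
- move=> m m' x /setU1P[-> | mM] /setU1P[-> | m'M] // exm exm'.
  + exact: rdisj exm exm'.
  + by symmetry; apply: rdisj exm' exm.
  + exact: disj exm exm'.
Qed.

(** * Sizes of minimal transversals for one colour class *)

Section Core.
Variables (c : bool) (A : {set V}).
Hypotheses (Acol : forall a, a \in A -> chi a != c).
Hypothesis Adeg : forall a, a \in A -> 1 < #|N e a|.

(* The height-1 vertices, leaves being taken in the graph induced on A and its
   neighbours. *)
Definition twigs : {set V} :=
  [set q in A | [exists b in N e q, #|N e b :&: A| == 1]].

Lemma twigsP q : reflect (q \in A /\ exists2 b, e b q & #|N e b :&: A| = 1)
  (q \in twigs).
Proof.
rewrite inE; apply: (iffP andP) => -[qA].
  by case/exists_inP=> b; rewrite inE => ebq /eqP; split=> //; exists b.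
case=> b ebq cb; split=> //; apply/exists_inP; exists b; rewrite ?inE //.
exact/eqP.
Qed.

(** Conditions (1)-(3) for all components of one interior graph at once: the neighbourhoods of the
    twigs partition the vertices covered by [A], and each has at most one vertex in a further
    neighbourhood. *)
Definition grafted : Prop :=
  (forall b a, a \in A -> e b a -> #|N e b :&: twigs| = 1) /\
  (forall q x y, q \in twigs -> e x q -> e y q ->
     #|N e x :&: A| != 1 -> #|N e y :&: A| != 1 -> x = y).

(** Double counting of the adjacent pairs between [D] and the twigs: each member of either set has
    exactly one neighbour in the other. *)
Lemma grafted_card D : grafted -> mindom e A D -> #|D| = #|twigs|.
Proof.
case=> F1 F2 [/domP domD priv].
have c1 q : q \in twigs -> #|N e q :&: D| = 1.
  move=> qQ; have /twigsP[qA _] := qQ; have [x xD exq] := domD q qA.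
  suff -> : N e q :&: D = [set x] by rewrite cards1.
  (* If [q] is the only neighbour of [z] in [A], then [q] is private to [z]. *)
  have lf z y : z \in D -> y \in D -> e z q -> e y q -> #|N e z :&: A| == 1 -> y = z.
    move=> zD yD ezq eyq /cards1P[a Ea].
    have : q \in N e z :&: A by rewrite !inE es ezq.
    rewrite Ea inE => /eqP qa; have [a' [a'A eza' only]] := priv z zD.
    apply: only => //; have : a' \in N e z :&: A by rewrite !inE es eza'.
    by rewrite Ea inE -qa => /eqP->.
  apply/setP=> y; rewrite !inE; apply/andP/eqP => [[eyq yD] | ->]; last by [].
  have [cx | cx] := boolP (#|N e x :&: A| == 1); first exact: lf cx.
  have [cy | cy] := boolP (#|N e y :&: A| == 1); first by rewrite (lf y x).
  exact: F2 eyq exq cy cx.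
have sum1 (X Y : {set V}) : #|X :&: Y| = \sum_(y in Y) (y \in X).
  rewrite -sum1_card big_mkcond /= [RHS]big_mkcond /=; apply: eq_bigr => y _.
  by rewrite inE andbC; case: (y \in Y) (y \in X) => [] [].
transitivity (\sum_(x in D) #|N e x :&: twigs|).
  rewrite -sum1_card; apply: eq_bigr => x /priv[a [aA exa _]].
  by rewrite (F1 x a).
under eq_bigr => x _ do rewrite sum1.
rewrite exchange_big /= -sum1_card; apply: eq_bigr => q /c1 <-.
by rewrite sum1; apply: eq_bigr => x _; rewrite !inE es.
Qed.

(* Minimal dominating sets with prescribed elements are extracted from the
   complement of a neighbourhood (or two) to which these elements are added back;
   this complement still dominates A because T has no cycle of length 4 or 8. *)
Lemma unmixed_grafted :
  (forall D1 D2, mindom e A D1 -> mindom e A D2 -> #|D1| = #|D2|) -> grafted.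
Proof.
move=> unm; have Anbr a : a \in A -> N e a != set0.
  by move/Adeg=> H; rewrite -card_gt0 ltnW.
have [M [D [sMA domD leDM disj]]] := konig Acol Anbr.
have [D0 sD0 mD0] := mindom_exists domD.
(* [D'] has the size of [D0], which is at most that of the matching [M]. *)
have key D' : mindom e A D' ->
  (forall x, x \in D' -> exists2 m, m \in M & e x m) /\
  (forall x y m, x \in D' -> y \in D' -> m \in M -> e x m -> e y m -> x = y).
  move=> mD'; apply: leq_card_select => //.
    by apply/domP=> m /(subsetP sMA); apply/domP; case: mD'.
  by rewrite (unm _ _ mD' mD0) (leq_trans (subset_leq_card sD0)).
have two a : a \in A -> exists x y, [/\ e x a, e y a & x != y].
  by case/Adeg/card_gt1P=> x [y []]; rewrite !inE => xa ya nxy; exists x, y.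
have C4 := acyclic_C4 es ei ac.
(* With the other neighbours of [a] deleted, only [b] can dominate [a]. Any other [a'] shares at
   most one of its two neighbours with [a], so it stays dominated. *)
have P1 b a : a \in A -> e b a -> exists2 m, m \in M & e b m.
  move=> aA eba; have domW : dom e A (~: N e a :|: [set b]).
    apply/domP=> a' a'A; have [x [y [exa' eya' nxy]]] := two _ a'A.
    have [<- | naa'] := eqVneq a a'; first by exists b; rewrite ?inE ?eqxx ?orbT.
    have [exa | nexa] := boolP (e x a); last by exists x; rewrite ?inE ?nexa.
    exists y; rewrite ?inE //; case eya: (e y a) => //=.
    by rewrite (C4 a a' x y) ?eqxx // in nxy.
  have [D' sD' mD'] := mindom_exists domW; have [K1 _] := key _ mD'.
  apply: K1; have [x xD' exa] := domP _ _ _ mD'.1 a aA.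
  have := subsetP sD' x xD'; rewrite !inE exa /= => /eqP xb.
  by rewrite -xb.
have other m x : m \in M -> e x m -> #|N e x :&: A| != 1 ->
    exists s, [/\ s \in A, e x s & s != m].
  move=> mM exm cx; have mX : m \in N e x :&: A by rewrite !inE es exm (subsetP sMA).
  have /card_gt1P : 1 < #|N e x :&: A|.
    by rewrite ltn_neqAle eq_sym cx; apply/card_gt0P; exists m.
  case=> s1 [s2 []]; rewrite !inE ![e _ x]es => /andP[e1 A1] /andP[e2 A2] ns.
  have [s1m | ] := eqVneq s1 m; last by exists s1.
  by exists s2; rewrite -s1m eq_sym.
(* [s1] and [s2] are further members of [A] next to [x] and [y]. Deleting their other neighbours
   forces both [x] and [y] into a minimal dominating set, which then meets the neighbourhood of [m]
   twice. *)
have P2 m x y : m \in M -> e x m -> e y m ->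
    #|N e x :&: A| != 1 -> #|N e y :&: A| != 1 -> x = y.
  move=> mM exm eym cx cy; apply: contraTeq isT => nxy.
  have [s1 [s1A exs1 ns1m]] := other _ _ mM exm cx.
  have [s2 [s2A eys2 ns2m]] := other _ _ mM eym cy.
  have neys1 : ~~ e y s1.
    by apply: contraNN nxy => eys1; apply/eqP;
      apply: C4 exm exs1 eym eys1 _; rewrite eq_sym.
  have nexs2 : ~~ e x s2.
    by apply: contraNN nxy => exs2; apply/eqP;
      apply: C4 exm exs2 eym eys2 _; rewrite eq_sym.
  have domW : dom e A (~: (N e s1 :|: N e s2) :|: [set x; y]).
    apply/forall_inP=> t tA; apply: contraT => /exists_inPn none; exfalso.
    (* All neighbours of an undominated [t] are adjacent to [s1] or [s2]: two of them close a
       4-cycle if they share one of these, an 8-cycle otherwise. *)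
    have bad z : e z t -> [&& e z s1 || e z s2, z != x & z != y].
      move=> ezt; apply: contraTT ezt => H; apply: none; rewrite !inE.
      by move: H; rewrite !negb_and !negbK orbA.
    have ntm : t != m.
      by apply/eqP=> tm; have := bad x; rewrite tm eqxx !andbF => /(_ exm).
    have nts1 : t != s1.
      by apply/eqP=> tm; have := bad x; rewrite tm eqxx !andbF => /(_ exs1).
    have nts2 : t != s2.
      by apply/eqP=> tm; have := bad y; rewrite tm eqxx !andbF => /(_ eys2).
    have [u [v [eut evt nuv]]] := two _ tA.
    case/and3P: (bad u eut) => /orP[eu|eu] nux nuy;
    case/and3P: (bad v evt) => /orP[ev|ev] nvx nvy.
    + by case/eqP: nuv; apply: C4 eut eu evt ev _.
    + exact: (acyclic_C8 es ei ac hchi exm eym nxy exs1 eys2 ns1m ns2m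
        ntm nts1 nts2 eu eut ev evt nuv nux nvy).
    + rewrite eq_sym in nuv.
      exact: (acyclic_C8 es ei ac hchi exm eym nxy exs1 eys2 ns1m ns2m
        ntm nts1 nts2 ev evt eu eut nuv nvx nuy).
    + by case/eqP: nuv; apply: C4 eut eu evt ev _.
  have [D' sD' mD'] := mindom_exists domW; have [_ K2] := key _ mD'.
  have := K2 x y m; rewrite exm eym mM => K2'.
  suff [xD yD] : x \in D' /\ y \in D' by rewrite K2' ?eqxx // in nxy.
  split.
    have [z zD' ez] := domP _ _ _ mD'.1 s1 s1A.
    have := subsetP sD' z zD'; rewrite !inE ez /= => /orP[]/eqP zE; subst z => //.
    by rewrite ez in neys1.
  have [z zD' ez] := domP _ _ _ mD'.1 s2 s2A.
  have := subsetP sD' z zD'; rewrite !inE ez orbT /= => /orP[]/eqP zE; subst z => //.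
  by rewrite ez in nexs2.
(* By [P2] two neighbours of a member of [M] cannot both have further neighbours in [A], so one is a
   leaf; conversely, [P1] at a leaf next to a twig can only return that twig. *)
have MQ : M = twigs.
  apply/setP=> q; apply/idP/twigsP => [qM | [qA [b ebq /eqP/cards1P[a Ea]]]].
    split; first exact: (subsetP sMA).
    have [x [y [exq eyq nxy]]] := two _ (subsetP sMA _ qM).
    have [cx | cx] := eqVneq #|N e x :&: A| 1; first by exists x.
    have [cy | cy] := eqVneq #|N e y :&: A| 1; first by exists y.
    by rewrite (P2 _ _ _ qM exq eyq cx cy) eqxx in nxy.
  have [m mM ebm] := P1 _ _ qA ebq.
  have : m \in N e b :&: A by rewrite !inE es ebm (subsetP sMA).
  have : q \in N e b :&: A by rewrite !inE es ebq.
  by rewrite Ea !inE => /eqP-> /eqP <-.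
split=> [b a aA eba | q x y]; rewrite -MQ; last exact: P2.
have [m mM ebm] := P1 _ _ aA eba; apply/eqP/cards1P; exists m.
apply/setP=> m'; rewrite !inE es; apply/andP/eqP => [[ebm' m'M] | ->] //.
exact: disj ebm' ebm.
Qed.

End Core.
End Hyper.

(** * Heights *)

Section Heights.
Variables (V : finType) (e : rel V) (chi : V -> bool).
Hypotheses (es : symmetric e) (ei : irreflexive e).
Hypothesis hchi : proper_2coloring e chi.

Lemma neq_colour x y c : e x y -> (chi x == c) = (chi y != c).
Proof. by move/hchi; case: (chi x) (chi y) c => [] [] []. Qed.

Lemma walk_reach_cons (S : {set V}) d v w u :
  v \in S -> e v w -> u \in walk_reach e S d w -> u \in walk_reach e S d.+1 v.
Proof.
move=> vS evw; elim: d u => [|d IH] u.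
  rewrite walk_reach0 => /andP[uS /eqP uw]; rewrite {u}uw in uS *.
  by apply/walk_reachSP; split=> //; exists v; rewrite // walk_reach0 vS eqxx.
case/walk_reachSP=> uS [x /IH xd exu].
by apply/walk_reachSP; split=> //; exists x.
Qed.

Section Subset.
Variable C : {set V}.

Lemma leaf_atP d v :
  reflect (exists2 u, u \in walk_reach e C d v & leafS e C u) (leaf_at e C d v).
Proof. exact: exists_inP. Qed.

Lemma leaf_at0 v : leaf_at e C 0 v = leafS e C v.
Proof.
apply/leaf_atP/idP => [[u] | lv].
  by rewrite walk_reach0 => /andP[_ /eqP->].
by exists v; rewrite // walk_reach0 eqxx andbT; case/andP: lv.
Qed.

Lemma leaf_at1 v : v \in C ->
  reflect (exists2 u, e u v & leafS e C u) (leaf_at e C 1 v).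
Proof.
move=> vC; apply: (iffP (leaf_atP _ _)) => -[u].
  case/walk_reachSP=> _ [w]; rewrite walk_reach0 => /andP[_ /eqP->].
  by rewrite es; exists u.
move=> euv lu; exists u => //; apply/walk_reachSP; split; first by case/andP: lu.
by exists v; rewrite 1?es // walk_reach0 vC eqxx.
Qed.

Lemma Vk_leaf_at k v : v \in Vk e C k -> ~~ isolatedS e C v ->
  leaf_at e C k v /\ forall j, j < k -> ~~ leaf_at e C j v.
Proof.
rewrite inE => /andP[_ H] /negPf iso; move: H; rewrite iso.
case/andP=> lk /forallP H; split=> // j ltjk; exact: (H (Ordinal ltjk)).
Qed.

Lemma leaf_at_Vk k v : v \in C -> ~~ isolatedS e C v -> leaf_at e C k v ->
  (forall j, j < k -> ~~ leaf_at e C j v) -> v \in Vk e C k.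
Proof.
move=> vC /negPf iso lk H; rewrite inE vC iso lk.
by apply/forallP=> j; apply: H.
Qed.

Lemma leaf_at_height d v : v \in C -> ~~ isolatedS e C v -> leaf_at e C d v ->
  exists k, v \in Vk e C k.
Proof.
move=> vC iso ld; have ex : exists d, leaf_at e C d v by exists d.
case: (ex_minnP ex) => k lk mink; exists k; apply: leaf_at_Vk => // j.
by apply: contraL => /mink; rewrite -leqNgt.
Qed.

Lemma Vk1P v :
  reflect [/\ v \in C, ~~ leafS e C v & exists2 u, e u v & leafS e C u]
          (v \in Vk e C 1).
Proof.
apply: (iffP idP) => [H | [vC nl [u euv lu]]].
  have vC : v \in C by move: H; rewrite inE => /andP[].
  have iso : ~~ isolatedS e C v.
    by apply/negP=> iso; move: H; rewrite inE iso andbF.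
  have [/(leaf_at1 vC)l1 /(_ 0 isT)] := Vk_leaf_at H iso.
  by rewrite leaf_at0.
apply: leaf_at_Vk => //; last by case=> // _; rewrite leaf_at0.
- apply/negP=> /andP[_ /eqP/setP/(_ u)].
  by rewrite !inE es euv; case/andP: lu => ->.
- by apply/(leaf_at1 vC); exists u.
Qed.

(* Rooting the tree at v, a vertex of maximal depth reachable from v is a leaf. *)
Lemma leaf_reachable : connected_graph e -> acyclic_graph e ->
  forall v, v \in C -> ~~ isolatedS e C v -> exists d, leaf_at e C d v.
Proof.
move=> cn ac v vC iso.
have [d [d0 d_edge _ uniq_parent]] := tree_depth es ei cn ac hchi v.
have vv : v \in [set u | connect (eS e C) v u] by rewrite inE connect0.
case: (arg_maxnP d vv) => w; rewrite -/(w \in _) inE => vw wmax.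
have [u0] : exists u, u \in NSub e C v.
  by apply/set0Pn; move: iso; rewrite /isolatedS vC.
rewrite inE => /andP[u0C evu0].
(* A neighbour of the root [v] in [C] is deeper than [v], so the deepest vertex is not [v]. *)
have nwv : w != v.
  apply/eqP=> wv; have := wmax u0; rewrite -/(u0 \in _) inE wv d0 => H.
  have : d u0 <= 0 by apply/H/connect1; rewrite /eS /= vC u0C.
  by case: (d_edge _ _ evu0); rewrite d0 // => ->.
have [t ht] := connect_walk_reach vC vw; exists t; apply/leaf_atP; exists w => //.
case: t ht => [|t]; first by rewrite walk_reach0 (negPf nwv) andbF.
case/walk_reachSP=> wC [p pt epw]; rewrite /leafS wC /=.
apply/cards1P; exists p.
(* As [w] is deepest, its neighbours in [C] lie above it, and there is only one such vertex. *)
have below u : u \in C -> e w u -> d u < d w.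
  move=> uC ewu; have : d u <= d w.
    apply: wmax; rewrite -/(u \in _) inE; apply: connect_trans vw _.
    by apply: connect1; rewrite /eS /= wC uC.
  by case: (d_edge _ _ ewu) => -> //; rewrite ltnn.
apply/setP=> u; rewrite !inE; apply/andP/eqP => [[uC ewu] | ->].
  have pC := walk_reach_sub pt.
  by apply: (uniq_parent w); rewrite 1?es // ?below // es.
by rewrite es (walk_reach_sub pt).
Qed.

End Subset.

(** * Leaves and heights in a component of an interior graph *)

Section Component.
Variables (c : bool) (A C : {set V}).
Hypotheses (Acol : forall a, a \in A -> chi a != c).
Hypothesis Adeg : forall a, a \in A -> 1 < #|N e a|.
Hypothesis CN : forall v, v \in C -> chi v = c -> NSub e C v = N e v :&: A.
Hypothesis CA : forall v, v \in C -> chi v != c -> v \in A.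
Hypothesis CNA : forall v, v \in C -> chi v != c -> NSub e C v = N e v.

(** Vertices of the other colour keep all their neighbours in [C], so their degree exceeds 1 and
    every leaf has colour [c]. *)
Lemma component_leaf v :
  leafS e C v = [&& v \in C, chi v == c & #|N e v :&: A| == 1].
Proof.
rewrite /leafS; case vC: (v \in C) => //=; case: (eqVneq (chi v) c) => cv /=.
  by rewrite CN.
by rewrite CNA // gtn_eqF // Adeg // CA.
Qed.

Lemma component_isolated v :
  isolatedS e C v = [&& v \in C, chi v == c & N e v :&: A == set0].
Proof.
rewrite /isolatedS; case vC: (v \in C) => //=; case: (eqVneq (chi v) c) => cv /=.
  by rewrite CN.
by rewrite CNA // -cards_eq0 gtn_eqF // ltnW // Adeg // CA.
Qed.

(** Since all leaves have colour [c], the colour of a vertex fixes the parity of its walks to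
    leaves. *)
Lemma leaf_at_colour d v : leaf_at e C d v -> chi v (+) odd d = c.
Proof.
case/leaf_atP=> u /(walk_reach_colour hchi)<-.
by rewrite component_leaf => /and3P[_ /eqP].
Qed.

Lemma component_Vk1 v : (v \in Vk e C 1) = (v \in C) && (v \in twigs e A).
Proof.
apply/Vk1P/andP => [[vC _ [u euv]] | [vC /twigsP[vA [b ebv cb]]]].
  rewrite component_leaf => /and3P[uC cu /eqP uA]; split=> //.
  apply/twigsP; split; last by exists u.
  by apply: CA => //; rewrite -(neq_colour _ euv).
have cv := Acol vA; split=> //; first by rewrite component_leaf (negPf cv) andbF.
exists b => //; rewrite component_leaf cb eqxx andbT (neq_colour _ ebv) cv andbT.
have : b \in NSub e C v by rewrite CNA // inE.
by rewrite inE => /andP[->].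
Qed.

Lemma component_Vk2P v :
  v \in Vk e C 2 -> [/\ v \in C, chi v = c, ~~ isolatedS e C v & #|N e v :&: A| != 1].
Proof.
move=> H; have vC : v \in C by move: H; rewrite inE => /andP[].
have iso : ~~ isolatedS e C v.
  by apply/negP=> iso; move: H; rewrite inE iso andbF.
have [/leaf_at_colour /= cv /(_ 0 isT)] := Vk_leaf_at H iso.
rewrite addbF in cv; rewrite leaf_at0 component_leaf vC cv eqxx => l0.
by split.
Qed.

(** The walk [v], [q], [b] ends at a leaf; length 0 fails as [v] is no leaf, and length 1 by
    parity. *)
Lemma component_Vk2 v q : v \in C -> chi v = c -> e v q -> q \in twigs e A ->
  #|N e v :&: A| != 1 -> v \in Vk e C 2.
Proof.
move=> vC cv evq qQ lv; have [qA [b ebq cb]] := twigsP _ _ _ qQ.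
have cq := Acol qA.
have qC : q \in C.
  have : q \in NSub e C v by rewrite CN // !inE es evq.
  by rewrite inE => /andP[].
have bC : b \in C.
  have : b \in NSub e C q by rewrite CNA // inE.
  by rewrite inE => /andP[].
apply: leaf_at_Vk => //.
- rewrite component_isolated vC cv eqxx /=; apply/set0Pn; exists q.
  by rewrite !inE es evq.
- apply/leaf_atP; exists b.
    apply/walk_reachSP; split=> //; exists q; last by rewrite es.
    apply/walk_reachSP; split=> //; exists v => //.
    by rewrite walk_reach0 vC eqxx.
  by rewrite component_leaf bC (neq_colour _ ebq) cq cb.
- case=> [|[|]] // _; first by rewrite leaf_at0 component_leaf (negPf lv) !andbF.
  by apply/negP=> /leaf_at_colour; rewrite cv; case: (c).
Qed.

Lemma component_Vk1_nbrs v : v \in C -> chi v = c ->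
  NSub e C v :&: Vk e C 1 = N e v :&: twigs e A.
Proof.
move=> vC cv; apply/setP=> q; rewrite [LHS]in_setI [RHS]in_setI component_Vk1 CN //.
apply/andP/andP=> -[]; first by rewrite inE => /andP[-> _] /andP[].
move=> vq qQ; have [qA _] := twigsP _ _ _ qQ; rewrite qQ andbT in_setI vq qA.
split=> //; have : q \in NSub e C v by rewrite CN // in_setI vq.
by rewrite inE => /andP[].
Qed.

(** A non-isolated vertex of colour [c] is a leaf or has a twig neighbour, so its height is 0 or 2;
    the other colour is at most one step further, whence the bound 3. *)
Lemma grafted_good : grafted e A -> good_component e C.
Proof.
case=> F1 F2.
have adj v : v \in C -> chi v = c -> ~~ isolatedS e C v ->
    #|N e v :&: twigs e A| = 1.
  move=> vC cv; rewrite component_isolated vC cv eqxx /= => /set0Pn[a].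
  by rewrite !inE es => /andP[eva aA]; apply: F1 eva.
have near v : v \in C -> chi v = c -> ~~ isolatedS e C v ->
    exists j, [/\ j <= 2, ~~ odd j & leaf_at e C j v].
  move=> vC cv iso; have [lv | lv] := eqVneq #|N e v :&: A| 1.
    by exists 0; split; rewrite // leaf_at0 component_leaf vC cv lv !eqxx.
  have /eqP/cards1P[q Eq] := adj v vC cv iso.
  have : q \in N e v :&: twigs e A by rewrite Eq inE.
  rewrite in_setI [q \in N e v]inE es => /andP[evq qQ].
  have v2 := component_Vk2 vC cv evq qQ lv.
  by exists 2; split=> //; have [] := Vk_leaf_at v2 iso.
split=> [k /set0Pn[v vk] | v v2 | v].
- have vC : v \in C by move: vk; rewrite inE => /andP[].
  have [iso | iso] := boolP (isolatedS e C v).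
    by move: vk; rewrite inE iso => /andP[_ /eqP->].
  have [_ Hk] := Vk_leaf_at vk iso; rewrite leqNgt; apply/negP=> ltk.
  have [cv | cv] := eqVneq (chi v) c.
    have [j [lej _ lj]] := near v vC cv iso.
    by have := Hk j (leq_ltn_trans lej (ltnW ltk)); rewrite lj.
  have [b] : exists b, b \in N e v.
    by apply/card_gt0P; apply/ltnW/Adeg/CA.
  move=> bv; have bC : b \in C by move: bv; rewrite -CNA // inE => /andP[].
  rewrite inE in bv.
  have cb : chi b = c by apply/eqP; rewrite (neq_colour _ bv).
  have [|j [lej _ /leaf_atP[u uj lu]]] := near b bC cb.
    rewrite component_isolated bC cb eqxx /=; apply/set0Pn; exists v.
    by rewrite !inE es bv CA.
  have := Hk j.+1 (leq_ltn_trans (lej : j.+1 <= 3) ltk); case/negP.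
  apply/leaf_atP.
  by exists u => //; apply: walk_reach_cons uj; rewrite // es.
- have [vC cv iso _] := component_Vk2P v2.
  by rewrite component_Vk1_nbrs // adj.
rewrite component_Vk1 => /andP[vC vQ].
apply/card_le1_eqP => x y /setIP[+ /component_Vk2P[_ _ _ lx]].
move=> + /setIP[+ /component_Vk2P[_ _ _ ly]].
rewrite !inE => /andP[_ evx] /andP[_ evy].
by apply: (F2 v) => //; rewrite es.
Qed.

(** By parity and the bound 3, a non-isolated vertex of colour [c] that is no leaf has height 2.
    Conditions (2) and (3) then yield the clauses of [grafted] within [C]. *)
Lemma good_grafted : connected_graph e -> acyclic_graph e -> good_component e C ->
  (forall b, b \in C -> chi b = c -> ~~ isolatedS e C b ->
     #|N e b :&: twigs e A| = 1) /\
  (forall q x y, q \in twigs e A -> q \in C -> e x q -> e y q ->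
     #|N e x :&: A| != 1 -> #|N e y :&: A| != 1 -> x = y).
Proof.
move=> cn ac [hle G2 G3].
have nonleaf b : b \in C -> chi b = c -> ~~ isolatedS e C b ->
    #|N e b :&: A| != 1 -> b \in Vk e C 2.
  move=> bC cb iso lb; have [d ld] := leaf_reachable cn ac bC iso.
  have [k bk] := leaf_at_height bC iso ld.
  have : k <= 3 by apply: hle; apply/set0Pn; exists b.
  have [lk _] := Vk_leaf_at bk iso; have := leaf_at_colour lk; rewrite cb.
  case: k bk lk => [|[|[|[|k]]]] // bk lk; try by case: (c).
  by move: lk; rewrite leaf_at0 component_leaf (negPf lb) !andbF.
split=> [b bC cb iso | q x y qQ qC exq eyq lx ly].
  have [lb | lb] := eqVneq #|N e b :&: A| 1.
    (* The only neighbour in [A] of a leaf [b] is a twig by virtue of [b] itself. *)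
    rewrite -[RHS]lb; congr #|pred_of_set _|; apply/setP=> q; rewrite !in_setI.
    case qb: (q \in N e b) => //=; apply/idP/idP=> [/twigsP[] // | qA].
    by apply/twigsP; split=> //; exists b => //; rewrite es; rewrite inE in qb.
  by rewrite -component_Vk1_nbrs // G2 // nonleaf.
have qA : q \in A by case/twigsP: qQ.
have cq := Acol qA.
have Nq z : e z q -> #|N e z :&: A| != 1 -> z \in NSub e C q :&: Vk e C 2.
  move=> ezq lz; have zN : z \in NSub e C q by rewrite CNA // inE.
  have zC : z \in C by move: zN; rewrite inE => /andP[].
  have cz : chi z = c by apply/eqP; rewrite (neq_colour _ ezq).
  rewrite in_setI zN nonleaf // component_isolated zC cz eqxx /=.
  by apply/set0Pn; exists q; rewrite in_setI qA inE es ezq.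
have := G3 q; rewrite component_Vk1 qC qQ => /(_ isT)/card_le1_eqP H.
by apply: H; apply: Nq.
Qed.
End Component.
End Heights.

(** * Interior graphs *)

Section SmallTrees.
Variables (V : finType) (e : rel V).
Hypotheses (es : symmetric e) (ei : irreflexive e) (V2 : #|V| <= 2).

Lemma small_other (x y z : V) : x != y -> x != z -> y = z.
Proof.
move=> nxy nxz; apply: contraTeq V2 => nyz; rewrite -ltnNge.
have := subset_leq_card (subsetT [set x; y; z]); rewrite cardsT; apply: leq_trans.
by rewrite -setUA cardsU1 cards2 !inE negb_or nxy nxz nyz.
Qed.

Lemma adj_neq x y : e x y -> x != y.
Proof. by apply: contraTneq => ->; rewrite ei. Qed.

(** A vertex dominating [x] must itself be dominated, and only [x] can do so; hence the only TD-set
    is the whole vertex set. *)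
Lemma small_unmixed : unmixed e.
Proof.
suff T D : minimal_TDset e D -> D = setT by move=> D1 D2 /T-> /T->.
case/(minimal_TDset_mindom D es) => /domP domD _; apply/setP=> x; rewrite inE.
have [y yD eyx] := domD x (in_setT x); have [z zD ezy] := domD y (in_setT y).
rewrite es in ezy.
by rewrite (small_other (adj_neq eyx) (adj_neq ezy)).
Qed.

(** Every non-isolated vertex is a leaf, so all heights are 0. *)
Lemma small_good C : good_component e C.
Proof.
have V0 k v : v \in Vk e C k -> k = 0.
  move=> vk; have vC : v \in C by move: vk; rewrite inE => /andP[].
  have [iso | iso] := boolP (isolatedS e C v).
    by move: vk; rewrite inE iso => /andP[_ /eqP].
  have [_ Hk] := Vk_leaf_at vk iso; case: k Hk {vk} => // k /(_ 0 isT).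
  case/negP; rewrite leaf_at0 /leafS vC.
  move: iso; rewrite /isolatedS vC => /set0Pn[u uN].
  have /andP[_ evu] : (u \in C) && e v u by rewrite inE in uN.
  apply/cards1P; exists u; apply/setP=> w; rewrite in_set1.
  apply/idP/eqP=> [| ->] //; rewrite inE => /andP[_ evw].
  exact: small_other (adj_neq evw) (adj_neq evu).
split=> [k /set0Pn[v /V0->] | v /V0 | v /V0] //.
Qed.

End SmallTrees.

(** * Trees with at least three vertices *)

Section LargeTrees.
Variables (V : finType) (e : rel V) (chi : V -> bool).
Hypotheses (es : symmetric e) (ei : irreflexive e).
Hypotheses (cn : connected_graph e) (ac : acyclic_graph e).
Hypothesis hchi : proper_2coloring e chi.
Hypothesis V3 : 2 < #|V|.

Lemma has_neighbour v : exists u, e u v.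
Proof.
have [z nzv] : exists z, z != v.
  have /card_gt1P[x [y [_ _ nxy]]] : 1 < #|V| by apply: ltnW.
  by have [xv | ] := eqVneq x v; [exists y; rewrite -xv eq_sym | exists x].
have /connectP[[|w p] /=] := cn v z; first by move=> _ zv; rewrite zv eqxx in nzv.
by case/andP=> evw _ _; exists w; rewrite es.
Qed.

Lemma NSubT v : NSub e setT v = N e v.
Proof. by apply/setP=> u; rewrite !inE es. Qed.

Lemma leafST v : leafS e setT v = (#|N e v| == 1).
Proof. by rewrite /leafS inE NSubT. Qed.

(** Two adjacent leaves would be closed under adjacency and so exhaust the connected graph. *)
Lemma no_adjacent_leaves x y : e x y -> #|N e x| == 1 -> #|N e y| == 1 -> False.
Proof.
move=> exy /cards1P[u Eu] /cards1P[w Ew].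
have yu : y = u by apply/set1P; rewrite -Eu inE es.
have xw : x = w by apply/set1P; rewrite -Ew inE.
have cl : closed e (mem [set x; y]).
  apply: intro_closed; first exact: sym_connect_sym.
  move=> a b eab; rewrite !inE => /orP[]/eqP aE; rewrite {}aE in eab.
    have : b \in N e x by rewrite inE es.
    by rewrite Eu inE yu orbC => ->.
  have : b \in N e y by rewrite inE es.
  by rewrite Ew inE xw => ->.
have : #|V| <= #|[set x; y]|.
  apply/subset_leq_card/subsetP=> z _.
  by rewrite -(closed_connect cl (cn x z)) !inE eqxx.
by move/(leq_trans V3); rewrite cards2; case: (x != y).
Qed.

Section Side.
Variable c : bool.

(** In a tree with at least three vertices no support vertex is a leaf, so height 1 captures the
    support vertices exactly. *)
Definition supports : {set V} := Vk e setT 1 :&: [set v | chi v == c].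
(** These vertices remain to be dominated once the support vertices of colour [c] are chosen. *)
Definition inner : {set V} := [set a in interior e chi c | chi a != c].

Lemma supportsP s :
  reflect [/\ chi s = c, #|N e s| != 1 & exists2 l, e s l & N e l = [set s]]
          (s \in supports).
Proof.
rewrite in_setI [in X in _ && X]inE; apply: (iffP andP).
  case=> /Vk1P[//|_ + [l els]]; rewrite !leafST => ns /cards1P[s' Es'] /eqP cs.
  split=> //; exists l; first by rewrite es.
  have : s \in N e l by rewrite inE es.
  by rewrite Es' inE => /eqP->.
case=> cs ns [l esl El]; split; last exact/eqP.
apply/(Vk1P es); split; rewrite ?inE ?leafST //.
by exists l; rewrite 1?es // leafST El cards1.
Qed.

Lemma interiorP v :
  reflect (v \notin supports /\ forall s, s \in supports -> ~~ e v s)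
          (v \in interior e chi c).
Proof.
rewrite /interior -/supports /Ncl in_setC in_setU negb_or andbC.
apply: (iffP andP) => -[vS H]; split=> //.
  by move=> s sS; apply: contra H => evs; apply/bigcupP; exists s; rewrite // inE.
apply/bigcupP=> -[s sS]; rewrite inE => evs.
by have := H s sS; rewrite evs.
Qed.

Lemma innerP a :
  reflect (chi a != c /\ forall s, s \in supports -> ~~ e a s) (a \in inner).
Proof.
rewrite [_ \in inner]inE; apply: (iffP andP) => [[/interiorP[_ aS] ca] // | [ca aS]].
split=> //; apply/interiorP; split=> //.
by apply: contra ca => /supportsP[-> _ _].
Qed.

Lemma inner_neighbour a b :
  a \in inner -> e b a -> chi b = c /\ b \in interior e chi c.
Proof.
case/innerP=> ca aS eba; have cb : chi b == c by rewrite (neq_colour hchi _ eba).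
split; first exact/eqP.
apply/interiorP; split=> [|s /supportsP[cs _ _]].
  by apply/negP=> /aS; rewrite es eba.
by apply/negP=> /(neq_colour hchi c); rewrite cb cs eqxx.
Qed.

(** A leaf of the other colour is adjacent to a support vertex of colour [c], hence is not
    interior. *)
Lemma inner_degree a : a \in inner -> 1 < #|N e a|.
Proof.
case/innerP=> ca aS; rewrite ltn_neqAle eq_sym; apply/andP; split; last first.
  by have [u eua] := has_neighbour a; apply/card_gt0P; exists u; rewrite inE.
apply/negP=> /[dup] l1 /cards1P[s Es].
have esa : e s a by have := set11 s; rewrite -Es inE.
have := aS s; rewrite es esa => /(_ _)/negP[] //; apply/supportsP; split=> //.
- by apply/eqP; rewrite (neq_colour hchi _ esa).
- by apply/negP=> /(no_adjacent_leaves esa); apply.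
- by exists a.
Qed.

(** Each support vertex has a leaf as private neighbour, and [inner] vertices see no support vertex,
    so both kinds of private neighbours persist. *)
Lemma mindom_supports D :
  mindom e inner D -> mindom e [set a | chi a != c] (D :|: supports).
Proof.
case=> /domP domD priv.
have col x : x \in D -> chi x = c.
  by case/priv=> a [aA exa _]; case: (inner_neighbour aA exa).
split.
  apply/domP=> a; rewrite inE => ca; have [aI | aI] := boolP (a \in inner).
    by have [x xD exa] := domD a aI; exists x; rewrite // inE xD.
  have /existsP[s /andP[sS eas]] : [exists s, (s \in supports) && e a s].
    apply: contraR aI => /existsPn H; apply/innerP; split=> // s sS.
    by have := H s; rewrite sS.
  by exists s; rewrite 1?es // inE sS orbT.
move=> x /setUP[/priv[a [aA exa only]] | xS].
  have [ca aS] := innerP _ aA; exists a; split; rewrite ?inE // => y.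
  by case/setUP=> [/only // | /aS]; rewrite es => /negPf->.
have [cx _ [l exl El]] := supportsP _ xS; exists l; split=> //.
  by rewrite inE -(neq_colour hchi c exl) cx.
by move=> y _ eyl; apply/set1P; rewrite -El inE.
Qed.

(** Leaves force their support vertices into [D]; what is private to another vertex is adjacent to
    no support vertex, hence lies in [inner]. *)
Lemma mindom_inner D : mindom e [set a | chi a != c] D ->
  mindom e inner (D :\: supports) /\ supports \subset D.
Proof.
case=> /domP domD priv.
have sSD : supports \subset D.
  apply/subsetP=> s /supportsP[cs _ [l esl El]].
  have [|x xD exl] := domD l; first by rewrite inE -(neq_colour hchi c esl) cs.
  have : x \in N e l by rewrite inE.
  by rewrite El inE => /eqP<-.
split=> //; split.
  apply/domP=> a /innerP[ca aS]; have [|x xD exa] := domD a; first by rewrite inE.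
  exists x => //; rewrite inE xD andbT.
  by apply/negP=> /aS; rewrite es exa.
move=> x /setDP[xD xS]; have [a [ca exa only]] := priv x xD.
exists a; split=> //; last by move=> y /setDP[yD _]; apply: only.
rewrite inE in ca; apply/innerP; split=> // s sS; apply: contra xS => eas.
by rewrite -(only s) ?(subsetP sSD) // es.
Qed.

Lemma mindom_disjoint D : mindom e inner D -> [disjoint D & supports].
Proof.
case=> _ priv; apply/pred0P=> x; apply/negP=> /andP[/priv[a [/innerP[_ aS] exa _]]].
by move/aS; rewrite es exa.
Qed.

Lemma interior_component_NSub C v : is_component e (interior e chi c) C ->
  v \in C -> NSub e C v = NSub e (interior e chi c) v.
Proof.
case=> v0 _ -> /setIdP[vI v0v]; apply/setP=> u.
apply/setIdP/setIdP=> -[uI evu]; split=> //; first by case/setIdP: uI.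
apply/setIdP; split=> //; apply: connect_trans v0v _.
by apply: connect1; rewrite /eS /= vI uI.
Qed.

Lemma component_interior C v :
  is_component e (interior e chi c) C -> v \in C -> v \in interior e chi c.
Proof. by case=> v0 _ -> /setIdP[]. Qed.

(** Both clauses of [grafted] are local: each concerns neighbourhoods around one interior vertex,
    and these are seen within its component. *)
Lemma grafted_interior : grafted e inner <->
  (forall C, is_component e (interior e chi c) C -> good_component e C).
Proof.
have Acol a : a \in inner -> chi a != c by case/innerP.
have CN C v : is_component e (interior e chi c) C -> v \in C -> chi v = c ->
    NSub e C v = N e v :&: inner.
  move=> hC vC cv; rewrite (interior_component_NSub hC vC).
  apply/setP=> u; apply/setIdP/setIP=> [[uI evu] | [uN /setIdP[uI _]]].
    rewrite inE es; split=> //; apply/setIdP; split=> //.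
    by rewrite -(neq_colour hchi c evu) cv.
  by rewrite inE es in uN.
have CA C v : is_component e (interior e chi c) C -> v \in C -> chi v != c ->
    v \in inner.
  by move=> hC vC cv; apply/setIdP; rewrite (component_interior hC vC).
have CNA C v : is_component e (interior e chi c) C -> v \in C -> chi v != c ->
    NSub e C v = N e v.
  move=> hC vC cv; rewrite (interior_component_NSub hC vC).
  apply/setP=> u; rewrite [RHS]inE es; apply/setIdP/idP=> [[] // | evu].
  by split=> //; case: (inner_neighbour (CA _ _ hC vC cv) (b := u)); rewrite // es.
have loc C (hC : is_component e (interior e chi c) C) :=
  good_grafted es ei hchi Acol inner_degree
    (fun v => @CN C v hC) (fun v => @CA C v hC) (fun v => @CNA C v hC) cn ac.
split=> [gr C hC | good].
  by apply: (grafted_good es hchi Acol inner_degree _ _ _ gr);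
    [move=> v; apply: CN | move=> v; apply: CA | move=> v; apply: CNA].
have comp v : v \in interior e chi c -> exists C,
    [/\ is_component e (interior e chi c) C, v \in C & good_component e C].
  move=> vI.
  pose C := [set u in interior e chi c | connect (eS e (interior e chi c)) v u].
  have hC : is_component e (interior e chi c) C by exists v.
  by exists C; split; [| apply/setIdP; rewrite connect0 | apply: good].
split=> [b a aA eba | q x y qQ].
  have [cb bI] := inner_neighbour aA eba; have [C [hC bC gC]] := comp b bI.
  have [L1 _] := loc C hC gC; apply: L1 => //.
  rewrite /isolatedS bC (CN C) //; apply/set0Pn; exists a.
  by rewrite in_setI aA inE es eba.
have [qA _] := twigsP _ _ _ qQ; have : q \in interior e chi c by case/setIdP: qA.
by case/comp=> C [hC qC gC]; have [_ L2] := loc C hC gC; apply: L2.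
Qed.

End Side.

(** A minimal TD-set splits by colour, and each half consists of the forced support vertices and a
    minimal set for [inner]. *)
Lemma large_unmixed : unmixed e <->
  (forall c D1 D2, mindom e (inner c) D1 -> mindom e (inner c) D2 -> #|D1| = #|D2|).
Proof.
have split_dom D c : mindom e setT D ->
    mindom e [set a | chi a != c] (D :&: [set x | chi x == c]).
  case=> /domP domD priv; split.
    apply/domP=> a; rewrite inE => ca; have [x xD exa] := domD a (in_setT a).
    by exists x; rewrite // !inE xD (neq_colour hchi _ exa).
  move=> x; rewrite !inE => /andP[/priv[a [_ exa only]] cx]; exists a; split=> //.
    by rewrite inE -(neq_colour hchi _ exa).
  by move=> y; rewrite inE => /andP[yD _]; apply: only.
have col c D x : mindom e [set a | chi a != c] D -> x \in D -> chi x == c.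
  by case=> _ priv /priv[a [+ exa _]]; rewrite inE (neq_colour hchi _ exa).
have domT (B : {set V}) : dom e B setT.
  by apply/domP=> a _; have [u eua] := has_neighbour a; exists u.
split=> [unm c D1 D2 mD1 mD2 | side D1 D2].
  (* The same [D0], for the opposite colour, completes both sets, so their sizes grow by the same
     amount. *)
  have [D0 _ mD0] := mindom_exists (domT [set a | chi a != ~~ c]).
  have size D : mindom e (inner c) D ->
    minimal_TDset e ((D :|: supports c) :|: D0) /\
    #|(D :|: supports c) :|: D0| = #|D| + #|supports c| + #|D0|.
    move=> mD; have mDS := mindom_supports mD; split.
      apply/(minimal_TDset_mindom _ es).
      have -> : setT = [set a | chi a != c] :|: [set a | chi a != ~~ c].
        by apply/setP=> a; rewrite !inE; case: (chi a) (c) => [] [].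
      apply: mindomU => // x a /[dup] xD.
        move/(col _ _ _ mDS) => /eqP cx; rewrite inE => ca.
        apply: contra ca => /(neq_colour hchi c); rewrite cx eqxx.
        by case: (chi a) (c) => [] [].
      move/(col _ _ _ mD0) => /eqP cx; rewrite inE => ca.
      apply: contra ca => /(neq_colour hchi c); rewrite cx.
      by case: (chi a) (c) => [] [].
    rewrite !cardsU !disjoint_setI0 ?cards0 ?subn0 // ?mindom_disjoint //.
    apply/pred0P=> x; apply/negP=> /andP[/(col _ _ _ mDS)/eqP cx].
    by move/(col _ _ _ mD0); rewrite cx; case: (c).
  have [m1 c1] := size D1 mD1; have [m2 c2] := size D2 mD2.
  by have := unm _ _ m1 m2; rewrite c1 c2 => /addIn/addIn.
move=> /(minimal_TDset_mindom _ es) m1 /(minimal_TDset_mindom _ es) m2.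
have half c : #|D1 :&: [set x | chi x == c]| = #|D2 :&: [set x | chi x == c]|.
  have [i1 s1] := mindom_inner (split_dom _ c m1).
  have [i2 s2] := mindom_inner (split_dom _ c m2).
  rewrite -(cardsID (supports c) (D1 :&: _)) -(cardsID (supports c) (D2 :&: _)).
  by rewrite (setIidPr s1) (setIidPr s2) (side _ _ _ i1 i2).
rewrite -(cardsID [set x | chi x == true] D1) -(cardsID [set x | chi x == true] D2).
rewrite half; congr addn.
have setDE (D : {set V}) : D :\: [set x | chi x == true] = D :&: [set x | chi x == false].
  by apply/setP=> x; rewrite !inE andbC; case: (chi x).
by rewrite !setDE half.
Qed.

End LargeTrees.

Theorem theorem3p47 (V : finType) (e : rel V) (chi : V -> bool) :
  symmetric e -> irreflexive e -> is_tree e -> proper_2coloring e chi ->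
  unmixed e <->
  (forall (c : bool) (C : {set V}),
      is_component e (interior e chi c) C -> good_component e C).
Proof.
move=> es ei [_ cn ac] hchi; have [V2 | V3] := leqP #|V| 2.
  (* Up to two vertices, both sides of the equivalence hold outright. *)
  by split=> _; [move=> c C _; apply: small_good | apply: small_unmixed].
apply: (iff_trans (large_unmixed es cn hchi V3)); split=> H c.
  apply/(grafted_interior es ei cn ac hchi V3).
  apply: (unmixed_grafted es ei cn ac hchi (c := c) _ _ (H c)) => a; first by case/setIdP.
  by apply: inner_degree.
move=> D1 D2; have /(grafted_interior es ei cn ac hchi V3) gr := H c.
by move=> /(grafted_card es gr)-> /(grafted_card es gr)->.
Qed.
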